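(* Let $f:\mathbb{R}^n\to\mathbb{R}$ be convex, twice differentiable and bounded below, with $f^*:=\inf_x f(x)$, and suppose that $\|\nabla^2 f(x)-\nabla^2 f(y)\|\le M\|x-y\|$ for all $x,y\in\mathbb{R}^n$, where $M>0$. Suppose there is a constant $D>0$ such that every $x$ with $f(x)\le f(x_0)$ satisfies $\|x-x^*\|\le D$, where $x^*$ is a minimizer of $f$. Let $\epsilon>0$. Then the universal trust-region method with the simple strategy, started at $x_0$, takes $$O\left(\sqrt M\,D^{3/2}\,\epsilon^{-1/2}+\log\left(\|\nabla f(x_0)\|/\epsilon\right)\right)$$ iterations to find a point $x$ satisfying $f(x)-f^*\le O(\epsilon)$.
   Context: Norms are the Euclidean norm for vectors and the induced operator norm for matrices. The universal trust-region method with the simple strategy generates $x_{k+1}=x_k+d_k$, $k=0,1,2,\dots$, where $d_k$ is a (global) solution of $$\min_{d\in\mathbb{R}^n}\ \tfrac12 d^T\left(\nabla^2 f(x_k)+\sigma_k\|\nabla f(x_k)\|^{1/2}I\right)d+\nabla f(x_k)^Td\quad\text{s.t. }\|d\|\le r_k\|\nabla f(x_k)\|^{1/2},$$ with $(\sigma_k,r_k)=\left(\frac{\sqrt M}{3},\frac1{3\sqrt M}\right)$ for all $k$. The iteration bound is an asymptotic statement as $\epsilon\to0$ with an absolute implied constant. In the accuracy requirement $f(x)-f^*\le O(\epsilon)$ the implied constant may depend on $D$ but not on $\epsilon$. *)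

(* Defs.v *)
From HB Require Import structures.
From mathcomp Require Import all_boot all_order all_algebra.
From mathcomp Require Import all_classical all_reals all_analysis.

Set Implicit Arguments.
Unset Strict Implicit.
Unset Printing Implicit Defensive.

Import Order.TTheory GRing.Theory Num.Theory.
Import numFieldNormedType.Exports.

Local Open Scope classical_set_scope.
Local Open Scope ring_scope.

(* Points of R^n are row vectors, so the linear map with matrix A is
   v |-> v *m A and the column-vector expressions d^T A d and g^T d become
   d *m A *m d^T and g *m d^T.  The canonical norm on 'rV[R]_n is the maximum
   norm (same topology, hence same differentiability); the Euclidean norm has
   to be defined separately. *)

Section TrustRegion.
Context {R : realType} {n : nat}.
Implicit Types (f : 'rV[R]_n -> R) (x d v : 'rV[R]_n) (A : 'M[R]_n).

Definition enorm v : R := Num.sqrt (\sum_(i < n) v 0 i ^+ 2).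

Definition opnorm A : R :=
  sup [set enorm (v *m A) | v in [set v | enorm v <= 1]].

Definition gradient f x : 'rV[R]_n :=
  \row_(i < n) 'D_(delta_mx 0 i) (f : 'rV[R]_n -> R^o) x.

(* For row vectors, entry (i, j) of the Jacobian of the gradient is
   'D_(e_i) ('D_(e_j) f). *)
Definition hessian f x : 'M[R]_n := 'J (gradient f) x.

Definition twice_differentiable f :=
  (forall x, differentiable (f : 'rV[R]_n -> R^o) x) /\
  (forall x, differentiable (gradient f) x).

Definition tr_model f (sigma : R) x d : R :=
  2^-1 * (d *m (hessian f x +
                (sigma * Num.sqrt (enorm (gradient f x)))%:M) *m d^T) 0 0
  + (gradient f x *m d^T) 0 0.

Definition tr_feasible f (r : R) x : set 'rV[R]_n :=
  [set d | enorm d <= r * Num.sqrt (enorm (gradient f x))].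

Definition tr_solution f (sigma r : R) x d :=
  tr_feasible f r x d /\
  forall d', tr_feasible f r x d' -> tr_model f sigma x d <= tr_model f sigma x d'.

Definition utr_simple f (M : R) x0 (x : nat -> 'rV[R]_n) :=
  x 0%N = x0 /\
  forall k, exists2 d,
    tr_solution f (Num.sqrt M / 3) (3 * Num.sqrt M)^-1 (x k) d &
    x k.+1 = x k + d.

End TrustRegion.

(* Main.v *)
Require Import Defs.
From HB Require Import structures.
From mathcomp Require Import all_boot all_order all_algebra.
From mathcomp Require Import all_classical all_reals all_analysis.
From mathcomp Require Import ring lra.

Set Implicit Arguments.
Unset Strict Implicit.
Unset Printing Implicit Defensive.

Import Order.TTheory GRing.Theory Num.Theory.
Import numFieldNormedType.Exports.

Local Open Scope classical_set_scope.
Local Open Scope ring_scope.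

(** Write g_k for the norm of the gradient at x_k and delta_k = f (x_k) - f*.
    Every step makes one of two kinds of progress.

    Let H be the Hessian and grad the gradient at x_k, s = sqrt M,
    h = sqrt g_k, B = H + (s h / 3) I the matrix of the model and
    rho = h / (3 s) the radius. A global solution d minimises a convex quadratic
    over a ball, hence also the linear form of w = d B + grad over that ball,
    which means rho |w| <= - w . d ([ball_minimizer_residual]). This single
    inequality replaces the Lagrange multiplier:
    - w . d <= 0, so by Taylor f drops by at least (5/18) s h |d|^2;
    - |w| <= g_k, so the new gradient, which is w - (s h / 3) d up to the Taylor
      remainder M |d|^2 / 2, has norm at most g_k / 6 + |w| <= (7/6) g_k;
    - either w = 0, and the gradient shrinks by the factor 6, or |d| = rho, and f
      drops by at least (5/162) g_k^(3/2) / s.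
    This is [step_progress].

    By convexity delta_k <= D g_k, so the second kind of step gives
    delta_{k+1} <= delta_k - kappa delta_k^(3/2) with
    kappa = (5/162) / (sqrt M D^(3/2)), which raises 1 / sqrt delta_k by kappa / 2.
    The two kinds may alternate, and the second one may raise the gradient, but
    the potential 2 ln g_k - (3 / kappa) / sqrt delta_k drops by at least 1 in
    both cases ([step_count]). As long as delta_k > (1 + D) eps, both g_k and
    delta_k exceed eps, so the number of steps is at most
    2 ln (g_0 / eps) + (3 / kappa) / sqrt eps ([iteration_bound]). For
    eps < g_0 / 3 the logarithm also absorbs the rounding to an integer, and if
    g_0 = 0 then x_0 is already optimal.

    The calculus behind it consists of the two Taylor bounds with Lipschitz
    Hessian. Letting a scale tend to 0 in them yields the symmetry of H, without
    which w would not be the gradient of the model, and, from convexity, the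
    tangent inequality and the positivity of H. *)

(** * Euclidean geometry of row vectors *)

Section Euclidean.
Context {R : realType} {n : nat}.
Implicit Types (u v w : 'rV[R]_n) (A : 'M[R]_n).

(** The 1x1-matrix form in which [tr_model] writes its scalar products, so that
    the two agree by conversion. *)
Definition dot u v : R := (u *m v^T) 0 0.

Lemma dotE u v : dot u v = \sum_i u 0 i * v 0 i.
Proof. by rewrite /dot mxE; apply: eq_bigr => i _; rewrite mxE. Qed.

Lemma dotC u v : dot u v = dot v u.
Proof. by rewrite !dotE; apply: eq_bigr => i _; rewrite mulrC. Qed.

Lemma dotDl u v w : dot (u + v) w = dot u w + dot v w.
Proof. by rewrite /dot mulmxDl mxE. Qed.

Lemma dotZl a u w : dot (a *: u) w = a * dot u w.
Proof. by rewrite /dot -scalemxAl mxE. Qed.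

Lemma dot0l w : dot 0 w = 0.
Proof. by rewrite /dot mul0mx mxE. Qed.

Lemma dotNl u w : dot (- u) w = - dot u w.
Proof. by rewrite -scaleN1r dotZl mulN1r. Qed.

Lemma dotDr u v w : dot w (u + v) = dot w u + dot w v.
Proof. by rewrite dotC dotDl !(dotC w). Qed.

Lemma dotZr a u w : dot w (a *: u) = a * dot w u.
Proof. by rewrite dotC dotZl (dotC w). Qed.

Lemma dotNr u w : dot w (- u) = - dot w u.
Proof. by rewrite dotC dotNl (dotC w). Qed.

Definition dot_linE := (dotDl, dotDr, dotNl, dotNr, dotZl, dotZr).

Lemma dot_ge0 u : 0 <= dot u u.
Proof. by rewrite dotE; apply: sumr_ge0 => i _; rewrite -expr2 sqr_ge0. Qed.

Lemma enorm_ge0 u : 0 <= enorm u.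
Proof. exact: sqrtr_ge0. Qed.

Lemma enorm_sqr u : enorm u ^+ 2 = dot u u.
Proof.
rewrite /enorm sqr_sqrtr; last by apply: sumr_ge0 => i _; rewrite sqr_ge0.
by rewrite dotE; apply: eq_bigr => i _; rewrite expr2.
Qed.

Lemma enorm_sqrt u : enorm u = Num.sqrt (dot u u).
Proof. by rewrite -enorm_sqr sqrtr_sqr ger0_norm// enorm_ge0. Qed.

Lemma enormZ a u : enorm (a *: u) = `|a| * enorm u.
Proof.
by rewrite !enorm_sqrt !dot_linE mulrA -expr2 sqrtrM ?sqr_ge0// sqrtr_sqr.
Qed.

Lemma enormN u : enorm (- u) = enorm u.
Proof. by rewrite -scaleN1r enormZ normrN1 mul1r. Qed.

Lemma enorm0 : enorm (0 : 'rV[R]_n) = 0.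
Proof. by rewrite -(scale0r 0) enormZ normr0 mul0r. Qed.

Lemma enorm_eq0 u : enorm u = 0 -> u = 0.
Proof.
move=> u0; apply/rowP => i; rewrite mxE; apply/eqP.
rewrite -sqrf_eq0 eq_le sqr_ge0 andbT -[leRHS](expr0n R 2) -u0 enorm_sqr dotE.
rewrite (bigD1 i)//= -expr2 lerDl.
by apply: sumr_ge0 => j _; rewrite -expr2 sqr_ge0.
Qed.

(** Cauchy-Schwarz: expand the square of the norm of
    |v|^2 u - (u . v) v, which is |v|^2 (|u|^2 |v|^2 - (u . v)^2). *)
Lemma normr_dot_le u v : `|dot u v| <= enorm u * enorm v.
Proof.
have [/enorm_eq0 ->|v0] := eqVneq (enorm v) 0.
  by rewrite enorm0 mulr0 dotC dot0l normr0.
have v2 : 0 < enorm v ^+ 2 by rewrite exprn_gt0// lt_def v0 enorm_ge0.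
have := dot_ge0 (dot v v *: u - dot u v *: v).
rewrite !dot_linE (dotC v u) -!enorm_sqr => H.
rewrite -(@ler_pXn2r _ 2)// ?nnegrE ?mulr_ge0 ?enorm_ge0//.
rewrite real_normK ?num_real// exprMn -subr_ge0 -(pmulr_rge0 _ v2).
by apply: le_trans H _; rewrite le_eqVlt; apply/orP; left; apply/eqP; ring.
Qed.

Lemma dot_le_enorm u v : dot u v <= enorm u * enorm v.
Proof. exact: le_trans (ler_norm _) (normr_dot_le _ _). Qed.

Lemma ler_enormD u v : enorm (u + v) <= enorm u + enorm v.
Proof.
rewrite -(@ler_pXn2r _ 2)// ?nnegrE ?addr_ge0 ?enorm_ge0//.
rewrite enorm_sqr !dot_linE -!enorm_sqr (dotC v u).
have := dot_le_enorm u v; nra.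
Qed.

(** The supremum that defines [opnorm] is meaningful only for a bounded set; the
    Frobenius norm of A is a bound. *)
Lemma enorm_mulmx_bounded A :
  has_ubound [set enorm (v *m A) | v in [set v | enorm v <= 1]].
Proof.
exists (Num.sqrt (\sum_j enorm (row j A^T) ^+ 2)) => _ [v /= v1 <-].
rewrite /enorm; apply: ler_wsqrtr; apply: ler_sum => j _.
have -> : (v *m A) 0 j = dot v (row j A^T).
  by rewrite mxE dotE; apply: eq_bigr => i _; rewrite !mxE.
rewrite -real_normK ?num_real// ler_pXn2r ?nnegrE ?enorm_ge0//.
by apply: le_trans (normr_dot_le _ _) _; rewrite ler_piMl ?enorm_ge0.
Qed.

Lemma enorm_mulmx_le_opnorm v A : enorm (v *m A) <= enorm v * opnorm A.
Proof.
have [/enorm_eq0 ->|v0] := eqVneq (enorm v) 0.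
  by rewrite mul0mx enorm0 mul0r.
have vgt0 : 0 < enorm v by rewrite lt_def v0 enorm_ge0.
rewrite mulrC -ler_pdivrMr//; apply: ub_le_sup; first exact: enorm_mulmx_bounded.
have nV : `|(enorm v)^-1| = (enorm v)^-1 by rewrite ger0_norm// invr_ge0 enorm_ge0.
exists ((enorm v)^-1 *: v) => /=; first by rewrite enormZ nV mulVf.
by rewrite -scalemxAl enormZ nV mulrC.
Qed.

End Euclidean.

(** * Taylor bounds for a function with Lipschitz Hessian *)

Section Taylor1D.
Context {R : realType}.

(** Mean value theorem for phi t - c t^(m+1) / (m+1), whose derivative is at
    most 0: integrating the bound on the derivative without an integral. *)
Lemma mvt_power_ub (phi dphi : R -> R) (c : R) (m : nat) :
  (forall t : R, is_derive t (1 : R) phi (dphi t)) ->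
  (forall t, 0 <= t -> t <= 1 -> dphi t <= c * t ^+ m) ->
  phi 1 - phi 0 <= c / m.+1%:R.
Proof.
move=> dp le_dp.
pose h (t : R) := phi t - c / m.+1%:R * t ^+ m.+1.
have dh (t : R) : is_derive t (1 : R) h (dphi t - c * t ^+ m).
  have dX := is_derive_poly ((c / m.+1%:R) *: 'X^(m.+1)) t.
  have -> : h = phi - horner ((c / m.+1%:R) *: 'X^(m.+1)).
    by apply/funext => s; rewrite /h -hornerXn -hornerZ.
  have -> : c * t ^+ m = (((c / m.+1%:R) *: 'X^(m.+1))^`()).[t].
    rewrite derivZ derivXn hornerZ hornerMn hornerXn /= -[t ^+ m *+ _]mulr_natr.
    by field; rewrite addrC natr1 pnatr_eq0.
  exact: is_deriveB.
have ch : {within `[0, 1 : R], continuous h}.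
  apply: continuous_subspaceT => t; apply/differentiable_continuous.
  by apply/derivable1_diffP; case: (dh t).
have [t /[!in_itv]/= /andP[t0 t1]] :=
  MVT_segment (@ler01 R) (fun t _ => dh t) ch.
rewrite subr0 mulr1 => E.
have : h 1 - h 0 <= 0 by rewrite E subr_le0 le_dp.
have -> : h 1 - h 0 = phi 1 - phi 0 - c / m.+1%:R.
  by rewrite /h expr1n expr0n/= mulr1 mulr0 subr0 addrAC.
by rewrite subr_le0.
Qed.

Lemma mvt_power (phi dphi : R -> R) (c : R) (m : nat) :
  (forall t : R, is_derive t (1 : R) phi (dphi t)) ->
  (forall t, 0 <= t -> t <= 1 -> `|dphi t| <= c * t ^+ m) ->
  `|phi 1 - phi 0| <= c / m.+1%:R.
Proof.
move=> dp le_dp; rewrite ler_norml; apply/andP; split; last first.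
  apply: mvt_power_ub dp _ => t t0 t1.
  exact: le_trans (ler_norm _) (le_dp t t0 t1).
have dpN (t : R) : is_derive t (1 : R) (- phi) (- dphi t) by exact: is_deriveN.
rewrite lerNl opprB -[phi 0]opprK addrC.
apply: (mvt_power_ub dpN) => t t0 t1; apply: le_trans (le_dp t t0 t1).
by rewrite -normrN ler_norm.
Qed.

(** Passing to the limit t -> 0; each first- or second-order condition below is
    read off an inequality at scale t in this way. *)
Lemma ge0_of_small_perturbation (a b : R) :
  (forall t, 0 < t -> t <= 1 -> 0 <= a + t * b) -> 0 <= a.
Proof.
move=> H; rewrite leNgt; apply/negP => a0.
(* at this scale the perturbation is smaller than |a| *)
pose t := - a / (`|b| - a + 1).
have den : 0 < `|b| - a + 1 by have := normr_ge0 b; lra.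
have t0 : 0 < t by rewrite divr_gt0// oppr_gt0.
have t1 : t <= 1 by rewrite ler_pdivrMr//; have := normr_ge0 b; lra.
have tden : t * (`|b| - a + 1) = - a by rewrite divfK ?gt_eqF.
have := H t t0 t1; have := ler_norm b; nra.
Qed.

End Taylor1D.

Section TaylorLine.
Context {R : realType} {n : nat}.
Implicit Types (x d u : 'rV[R]_n).

Lemma is_derive_line (W : normedModType R) (F : 'rV[R]_n -> W) x d (t : R) :
  differentiable F (x + t *: d) ->
  is_derive t (1 : R) (fun s : R => F (x + s *: d)) ('D_d F (x + t *: d)).
Proof.
move=> /(@diff_derivable _ _ _ _ _ d) dF.
have E : (fun h : R => h^-1 *: (F (x + (h *: 1 + t) *: d) - F (x + t *: d))) =
         (fun h : R => h^-1 *: (F (h *: d + (x + t *: d)) - F (x + t *: d))).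
  apply/funext => h; have -> : h *: (1 : R) = h by exact: mulr1.
  by rewrite scalerDl addrCA.
by apply: DeriveDef; rewrite /derivable /derive /= E.
Qed.

Lemma is_derive_dot (G : R -> 'rV[R]_n) (dG : 'rV[R]_n) u (t : R) :
  is_derive t (1 : R) G dG ->
  is_derive t (1 : R) (fun s => dot (G s) u) (dot dG u).
Proof.
case=> /[dup] /derivable_mxP dGij dGt <-.
have -> : (fun s => dot (G s) u) = \sum_i (u 0 i \*: (fun s => G s 0 i)).
  apply/funext => s; rewrite fct_sumE dotE.
  by apply: eq_bigr => i _; rewrite /= mulrC.
have -> : dot ('D_1 G t) u = \sum_i u 0 i *: 'D_1 (fun s => G s 0 i) t.
  by rewrite dotE derive_mx//; apply: eq_bigr => i _; rewrite mxE mulrC.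
by apply: is_derive_sum => i; apply: is_deriveZ; exact/derivableP.
Qed.

Lemma derive_gradient (f : 'rV[R]_n -> R) x d :
  differentiable (f : 'rV[R]_n -> R^o) x ->
  'D_d (f : 'rV[R]_n -> R^o) x = dot (gradient f x) d.
Proof.
move=> dfx; rewrite deriveE// [in LHS](row_sum_delta d) linear_sum dotE.
by apply: eq_bigr => i _; rewrite linearZ mxE deriveE//= mulrC.
Qed.

End TaylorLine.

Section TaylorLipschitzHessian.
Context {R : realType} {n : nat} (f : 'rV[R]_n -> R) (M : R).
Hypothesis M_ge0 : 0 <= M.
Hypothesis f_diff : twice_differentiable f.
Hypothesis hessian_lip :
  forall y z, opnorm (hessian f y - hessian f z) <= M * enorm (y - z).
Implicit Types (x d u v : 'rV[R]_n).

Lemma hessian_lip_dot x a u v :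
  `|dot (u *m (hessian f (x + a) - hessian f x)) v| <=
  M * enorm a * enorm u * enorm v.
Proof.
apply: le_trans (normr_dot_le _ _) _; apply: ler_wpM2r; first exact: enorm_ge0.
apply: le_trans (enorm_mulmx_le_opnorm _ _) _; rewrite mulrC.
apply: ler_wpM2r; first exact: enorm_ge0.
by apply: le_trans (hessian_lip _ _) _; rewrite addrAC subrr add0r.
Qed.

(** The mean value theorem needs a scalar function: the gradient along the
   segment is tested against a fixed u. *)
Let gradient_taylor_dot x d u :
  dot (gradient f (x + d) - gradient f x - d *m hessian f x) u <=
  M / 2 * enorm d ^+ 2 * enorm u.
Proof.
pose G (t : R) := gradient f (x + t *: d).
pose phi (t : R) := dot (G t) u - horner (dot (d *m hessian f x) u *: 'X) t.
have dphi (t : R) : is_derive t (1 : R) phi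
    (dot (d *m (hessian f (x + t *: d) - hessian f x)) u).
  have dG : is_derive t (1 : R) G (d *m hessian f (x + t *: d)).
    rewrite /hessian -deriveEjacobian; last exact: f_diff.2.
    by apply: is_derive_line; exact: f_diff.2.
  have dp := is_derive_poly (dot (d *m hessian f x) u *: 'X) t.
  have -> : dot (d *m (hessian f (x + t *: d) - hessian f x)) u =
    dot (d *m hessian f (x + t *: d)) u
      - ((dot (d *m hessian f x) u *: 'X)^`()).[t].
    by rewrite mulmxBr !dot_linE derivZ derivX hornerZ hornerC mulr1.
  exact: is_deriveB (is_derive_dot u dG) dp.
have phi_le (t : R) : 0 <= t -> t <= 1 ->
    `|dot (d *m (hessian f (x + t *: d) - hessian f x)) u| <=
    M * enorm d ^+ 2 * enorm u * t ^+ 1.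
  move=> t0 _; apply: le_trans (hessian_lip_dot _ _ _ _) _.
  by rewrite enormZ ger0_norm// le_eqVlt; apply/orP; left; apply/eqP; ring.
have := le_trans (ler_norm _) (mvt_power dphi phi_le).
rewrite /phi /G !hornerZ !hornerX scale1r scale0r addr0 mulr1 mulr0 subr0.
rewrite !dot_linE => H; apply: le_trans (le_trans _ H) _.
  by rewrite addrAC.
by rewrite le_eqVlt; apply/orP; left; apply/eqP; ring.
Qed.

(** Testing the remainder against itself turns the scalar estimate along
    the segment into a bound of its norm. *)
Lemma gradient_taylor_remainder x d :
  enorm (gradient f (x + d) - gradient f x - d *m hessian f x) <=
  M / 2 * enorm d ^+ 2.
Proof.
set e := (X in enorm X).
have [->|e0] := eqVneq (enorm e) 0.
  by rewrite mulr_ge0 ?exprn_ge0 ?enorm_ge0// divr_ge0.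
have egt0 : 0 < enorm e by rewrite lt_def e0 enorm_ge0.
rewrite -(ler_pM2r egt0) -expr2 (enorm_sqr e); exact: gradient_taylor_dot.
Qed.

Lemma taylor_remainder x d :
  `|f (x + d) - f x - dot (gradient f x) d - 2^-1 * dot (d *m hessian f x) d|
  <= M / 6 * enorm d ^+ 3.
Proof.
pose p : {poly R} := dot (gradient f x) d *: 'X +
  (2^-1 * dot (d *m hessian f x) d) *: 'X^2.
pose phi (t : R) := f (x + t *: d) - horner p t.
have dphi (t : R) : is_derive t (1 : R) phi
    (dot (gradient f (x + t *: d) - gradient f x - t *: d *m hessian f x) d).
  have df : is_derive t (1 : R) (fun t : R => f (x + t *: d))
      (dot (gradient f (x + t *: d)) d).
    rewrite -derive_gradient; last exact: f_diff.1.
    by apply: (@is_derive_line _ _ R^o); exact: f_diff.1.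
  have -> : dot (gradient f (x + t *: d) - gradient f x
      - t *: d *m hessian f x) d = dot (gradient f (x + t *: d)) d - p^`().[t].
    rewrite !dot_linE -scalemxAl dotZl derivD !derivZ derivX derivXn hornerD.
    by rewrite !hornerZ hornerC hornerMn hornerXn/=; field.
  exact: is_deriveB df (is_derive_poly p t).
have phi_le (t : R) : 0 <= t -> t <= 1 ->
    `|dot (gradient f (x + t *: d) - gradient f x - t *: d *m hessian f x) d|
    <= M / 2 * enorm d ^+ 3 * t ^+ 2.
  move=> t0 _; apply: le_trans (normr_dot_le _ _) _.
  have := ler_wpM2r (enorm_ge0 d) (gradient_taylor_remainder x (t *: d)).
  rewrite enormZ ger0_norm// => H; apply: le_trans H _.
  by rewrite le_eqVlt; apply/orP; left; apply/eqP; ring.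
have := mvt_power dphi phi_le.
rewrite /phi /p !hornerD !hornerZ !hornerX !hornerXn scale1r scale0r addr0.
rewrite expr1n expr0n/= => H; apply: le_trans (le_trans _ H) _.
  by rewrite le_eqVlt; apply/orP; left; apply/eqP; congr (`|_|); ring.
by rewrite le_eqVlt; apply/orP; left; apply/eqP; field.
Qed.

(** Expand f (x + a + b) from x + a and f (x + b) from x, both along b, and
    compare the gradients and the Hessians at x + a and x; the constant M is
    generous. *)
Lemma mixed_difference x a b :
  `|f (x + a + b) - f (x + a) - f (x + b) + f x - dot (a *m hessian f x) b|
  <= M * (enorm a + enorm b) ^+ 3.
Proof.
(* stated for arbitrary reals, so that lra never has to decide whether two
   Hessians or gradients taken at different points are convertible *)
have sum4 (f11 f10 f01 f00 g1 g0 h1 h0 m c1 c2 c3 : R) :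
    `|f11 - f10 - g1 - 2^-1 * h1| <= c1 -> `|f01 - f00 - g0 - 2^-1 * h0| <= c1 ->
    `|h1 - h0| <= c2 -> `|g1 - g0 - m| <= c3 ->
    `|f11 - f10 - f01 + f00 - m| <= c1 + c1 + 2^-1 * c2 + c3.
  by rewrite !ler_norml; lra.
have T1 := taylor_remainder (x + a) b.
have T2 := taylor_remainder x b.
have := hessian_lip_dot x a b b; rewrite mulmxBr !dot_linE => T3.
have := le_trans (normr_dot_le _ b)
  (ler_wpM2r (enorm_ge0 b) (gradient_taylor_remainder x a)).
rewrite !dot_linE => T4.
have a0 := enorm_ge0 a; have b0 := enorm_ge0 b.
have B : M / 6 * enorm b ^+ 3 + M / 6 * enorm b ^+ 3
   + 2^-1 * (M * enorm a * enorm b * enorm b)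
   + M / 2 * enorm a ^+ 2 * enorm b <= M * (enorm a + enorm b) ^+ 3.
  rewrite -subr_ge0.
  rewrite (_ : _ - _ = M * (enorm a ^+ 3 + 5 / 2 * (enorm a ^+ 2 * enorm b)
    + 5 / 2 * (enorm a * enorm b ^+ 2) + 2 / 3 * enorm b ^+ 3)); last by field.
  by rewrite mulr_ge0// !addr_ge0// !mulr_ge0// ?exprn_ge0.
exact: le_trans (sum4 _ _ _ _ _ _ _ _ _ _ _ _ T1 T2 T3 T4) B.
Qed.

(** The mixed second difference of f along s u and s v does not see the order
    of the two increments, and it equals s^2 u H v up to O(s^3). *)
Lemma hessian_sym x u v :
  dot (u *m hessian f x) v = dot (v *m hessian f x) u.
Proof.
suff le_uv a b : dot (a *m hessian f x) b <= dot (b *m hessian f x) a.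
  by apply/eqP; rewrite eq_le !le_uv.
rewrite -subr_ge0.
apply: (@ge0_of_small_perturbation _ _ (2 * M * (enorm a + enorm b) ^+ 3)).
move=> t t0 _.
have Tab := mixed_difference x (t *: a) (t *: b).
have Tba := mixed_difference x (t *: b) (t *: a).
move: Tab Tba; rewrite -!scalemxAl !dot_linE !enormZ (gtr0_norm t0).
rewrite -!mulrDr [enorm b + _]addrC (addrAC x (t *: b)) !exprMn.
have cancel (s f11 f10 f01 f00 p q c : R) : 0 < s ->
    `|f11 - f10 - f01 + f00 - s * (s * p)| <= M * (s ^+ 3 * c) ->
    `|f11 - f01 - f10 + f00 - s * (s * q)| <= M * (s ^+ 3 * c) ->
    0 <= q - p + s * (2 * M * c).
  by move=> s0; rewrite -(pmulr_rge0 _ (exprn_gt0 2 s0)) !ler_norml; lra.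
exact: cancel.
Qed.

End TaylorLipschitzHessian.

(** * Convexity in first- and second-order form *)

Section Convex.
Context {R : realType} {n : nat} (f : 'rV[R]_n -> R) (M : R).
Hypothesis M_ge0 : 0 <= M.
Hypothesis f_diff : twice_differentiable f.
Hypothesis hessian_lip :
  forall y z, opnorm (hessian f y - hessian f z) <= M * enorm (y - z).
Hypothesis f_convex : convex_function (setT : set (convex_lmodType 'rV[R]_n)) f.
Implicit Types (x y d : 'rV[R]_n).

Lemma convex_segment x d (t : R) : 0 <= t -> t <= 1 ->
  f (x + t *: d) <= f x + t * (f (x + d) - f x).
Proof.
move=> t0 t1.
have H : f (t *: (x + d) + (1 - t) *: x) <= t * f (x + d) + (1 - t) * f x.
  exact: (@f_convex (Itv01 t0 t1) (x + d) x (in_setT _) (in_setT _)).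
have E : x + t *: d = t *: (x + d) + (1 - t) *: x.
  by rewrite scalerDr scalerBl scale1r [RHS]addrC addrA subrK.
rewrite E; apply: le_trans H _; lra.
Qed.

(** The quotient (f (x + t d) - f x) / t is at most f (x + d) - f x by convexity,
    and is grad . d up to O(t) by Taylor. *)
Lemma convex_tangent x y : f x + dot (gradient f x) (y - x) <= f y.
Proof.
pose d := y - x; have -> : y = x + d by rewrite addrC subrK.
rewrite addrAC subrr add0r -subr_ge0.
apply: (@ge0_of_small_perturbation _ _ (2^-1 * `|dot (d *m hessian f x) d|
   + M / 6 * enorm d ^+ 3)) => t t0 t1.
have C := convex_segment x d (ltW t0) t1.
have := taylor_remainder M_ge0 f_diff hessian_lip x (t *: d).
rewrite -scalemxAl !dot_linE enormZ (gtr0_norm t0) ler_norml => /andP[T _].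
have e0 := enorm_ge0 d.
have aux (ft f1 f0 g h e : R) : ft <= f0 + t * (f1 - f0) -> 0 <= e ->
    - (M / 6 * (t * e) ^+ 3) <= ft - f0 - t * g - 2^-1 * (t * (t * h)) ->
    0 <= f1 - (f0 + g) + t * (2^-1 * `|h| + M / 6 * e ^+ 3).
  move=> le_ft e_ge0 le_T; rewrite -(pmulr_rge0 _ t0).
  have tt : t ^+ 3 <= t ^+ 2 by rewrite exprS ler_piMl ?sqr_ge0.
  have h1 : 0 <= t ^+ 2 * (`|h| + h).
    by rewrite mulr_ge0 ?sqr_ge0// -lerBlDr sub0r -normrN ler_norm.
  have h2 : 0 <= (t ^+ 2 - t ^+ 3) * (M / 6 * e ^+ 3).
    by rewrite mulr_ge0 ?subr_ge0// mulr_ge0 ?exprn_ge0// divr_ge0.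
  lra.
exact: aux C e0 T.
Qed.

(** f lies above its tangent at x, so the second-order term of the expansion of
    f (x + t d) dominates - O(t^3). *)
Lemma hessian_psd x d : 0 <= dot (d *m hessian f x) d.
Proof.
apply: (@ge0_of_small_perturbation _ _ (M / 3 * enorm d ^+ 3)) => t t0 _.
have C := convex_tangent x (x + t *: d).
have := taylor_remainder M_ge0 f_diff hessian_lip x (t *: d).
move: C; rewrite addrAC subrr add0r -scalemxAl !dot_linE enormZ (gtr0_norm t0).
have aux (ft f0 g h e : R) : f0 + t * g <= ft ->
    `|ft - f0 - t * g - 2^-1 * (t * (t * h))| <= M / 6 * (t * e) ^+ 3 ->
    0 <= h + t * (M / 3 * e ^+ 3).
  by rewrite -(pmulr_rge0 _ (exprn_gt0 2 t0)) ler_norml; lra.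
exact: aux.
Qed.

End Convex.

(** * One trust-region step *)

Section Subproblem.
Context {R : realType} {n : nat} (B : 'M[R]_n) (g d : 'rV[R]_n) (rho : R).
Hypothesis B_sym : forall u v, dot (u *m B) v = dot (v *m B) u.
Hypothesis rho_ge0 : 0 <= rho.
Hypothesis d_feasible : enorm d <= rho.
Hypothesis d_min : forall d', enorm d' <= rho ->
  2^-1 * dot (d *m B) d + dot g d <= 2^-1 * dot (d' *m B) d' + dot g d'.

(** First-order condition in the direction of a feasible d'; the symmetry of B
    makes d B + g the gradient of the quadratic. *)
Lemma ball_minimizer_variational d' : enorm d' <= rho ->
  0 <= dot (d *m B + g) (d' - d).
Proof.
move=> d'_feasible; set v := d' - d.
apply: (@ge0_of_small_perturbation _ _ (2^-1 * dot (v *m B) v)) => t t0 t1.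
have feasible : enorm (d + t *: v) <= rho.
  have -> : d + t *: v = (1 - t) *: d + t *: d'.
    by rewrite scalerBl scalerBr scale1r addrA addrAC.
  apply: le_trans (ler_enormD _ _) _; rewrite !enormZ (gtr0_norm t0).
  rewrite ger0_norm ?subr_ge0//.
  have := ler_wpM2l (ltW t0) d'_feasible.
  have t1' : 0 <= 1 - t by rewrite subr_ge0.
  have := ler_wpM2l t1' d_feasible; lra.
clearbody v; rewrite -(pmulr_rge0 _ t0); have := d_min feasible.
by rewrite mulmxDl -!scalemxAl !dot_linE (B_sym v d); lra.
Qed.

(** By the variational inequality d minimises the linear form of w = d B + g
    over the ball, and the minimum of that form is - rho |w|, attained at
    - (rho / |w|) w. *)
Lemma ball_minimizer_residual :
  rho * enorm (d *m B + g) <= - dot (d *m B + g) d.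
Proof.
set w := d *m B + g.
have [w0|w0] := eqVneq (enorm w) 0.
  by rewrite (enorm_eq0 w0) enorm0 mulr0 dot0l oppr0.
have wgt0 : 0 < enorm w by rewrite lt_def w0 enorm_ge0.
have := @ball_minimizer_variational (- (rho / enorm w) *: w).
rewrite enormZ normrN ger0_norm ?divr_ge0 ?enorm_ge0// divfK// => /(_ (lexx _)).
rewrite -/w; clearbody w; rewrite dotDr dotZr dotNr -enorm_sqr => V.
have E : - (rho / enorm w) * enorm w ^+ 2 = - (rho * enorm w) by field.
by move: V; rewrite E; lra.
Qed.

End Subproblem.

Section Step.
Context {R : realType} {n : nat} (f : 'rV[R]_n -> R) (M : R).
Hypothesis M_gt0 : 0 < M.
Hypothesis f_diff : twice_differentiable f.
Hypothesis hessian_lip :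
  forall y z, opnorm (hessian f y - hessian f z) <= M * enorm (y - z).
Hypothesis f_convex : convex_function (setT : set (convex_lmodType 'rV[R]_n)) f.

(** The alternative is whether the residual w = d B + grad vanishes (d solves the
    regularised Newton equation) or not (d reaches the boundary). *)
Lemma step_progress (x d : 'rV[R]_n) :
  tr_solution f (Num.sqrt M / 3) (3 * Num.sqrt M)^-1 x d ->
  0 < enorm (gradient f x) ->
  let g := enorm (gradient f x) in
  let g' := enorm (gradient f (x + d)) in
  f (x + d) <= f x /\
  (g' <= g / 6 \/
   g' <= 7 / 6 * g /\
   f (x + d) <= f x - 5 / 162 * (g * Num.sqrt g) / Num.sqrt M).
Proof.
move=> [d_feas d_min] g_gt0 /=.
have M_ge0 := ltW M_gt0.
set g := enorm (gradient f x) in g_gt0 *.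
set s := Num.sqrt M in d_feas d_min *; set h := Num.sqrt g.
have s_gt0 : 0 < s by rewrite sqrtr_gt0.
have h_gt0 : 0 < h by rewrite sqrtr_gt0.
have ME : M = s ^+ 2 by rewrite sqr_sqrtr.
have gE : g = h ^+ 2 by rewrite sqr_sqrtr// ltW.
pose B := hessian f x + (s / 3 * h)%:M.
have dB (u : 'rV[R]_n) : u *m B = u *m hessian f x + (s / 3 * h) *: u.
  by rewrite mulmxDr mul_mx_scalar.
have B_sym u v : dot (u *m B) v = dot (v *m B) u.
  rewrite !dB !dot_linE (dotC u v).
  by rewrite (hessian_sym M_ge0 f_diff hessian_lip).
pose rho := (3 * s)^-1 * h.
have rho_gt0 : 0 < rho by rewrite mulr_gt0// invr_gt0 mulr_gt0.
have rhoE : 3 * s * rho = h by rewrite mulrA mulfV ?mul1r// mulf_neq0// gt_eqF.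
have opt := ball_minimizer_residual B_sym (ltW rho_gt0) d_feas d_min.
set w := d *m B + gradient f x in opt.
have e0 := enorm_ge0 d; have w0 := enorm_ge0 w.
have d_rho : enorm d <= rho := d_feas.
have psd := hessian_psd M_ge0 f_diff hessian_lip f_convex x d.
have wd : dot w d = dot (d *m hessian f x) d + s / 3 * h * enorm d ^+ 2
    + dot (gradient f x) d.
  by rewrite /w dB !dot_linE enorm_sqr.
have descent : f (x + d) <= f x - 5 / 18 * (s * h) * enorm d ^+ 2.
  have T := le_trans (ler_norm _) (taylor_remainder M_ge0 f_diff hessian_lip x d).
  have wd_le0 : dot w d <= 0.
    by rewrite -oppr_ge0; apply: le_trans opt; rewrite mulr_ge0// ltW.
  (* since s |d| <= h / 3, the cubic remainder is at most s h |d|^2 / 18 *)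
  have cubic : s ^+ 2 * enorm d ^+ 3 <= s * h / 3 * enorm d ^+ 2.
    rewrite -subr_ge0 -rhoE.
    have -> : s * (3 * s * rho) / 3 * enorm d ^+ 2 - s ^+ 2 * enorm d ^+ 3 =
      s ^+ 2 * enorm d ^+ 2 * (rho - enorm d) by field.
    by rewrite mulr_ge0 ?subr_ge0// mulr_ge0 ?sqr_ge0.
  move: T cubic wd_le0 psd; rewrite wd ME.
  have aux (f1 f0 q p c e2 e3 : R) : f1 - f0 - p - 2^-1 * q <= c / 6 * e3 ->
      c * e3 <= s * h / 3 * e2 -> q + s / 3 * h * e2 + p <= 0 -> 0 <= q ->
      f1 <= f0 - 5 / 18 * (s * h) * e2 by lra.
  exact: aux.
have w_le : enorm w <= g.
  have : rho * enorm w <= rho * g.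
    have gd : - dot (gradient f x) d <= g * rho.
      rewrite -dotNr; apply: le_trans (dot_le_enorm _ _) _.
      by rewrite enormN ler_wpM2l// enorm_ge0.
    apply: le_trans opt _; rewrite wd [leRHS]mulrC.
    have r0 : 0 <= s / 3 * h * enorm d ^+ 2.
      by rewrite mulr_ge0 ?sqr_ge0// mulr_ge0 ?divr_ge0// ltW.
    move: gd r0 psd; lra.
  by rewrite ler_pM2l.
have sd_le : 3 * s * enorm d <= h.
  by rewrite -rhoE ler_pM2l// mulr_gt0.
have grad_le : enorm (gradient f (x + d)) <= g / 6 + enorm w.
  have G := gradient_taylor_remainder M_ge0 f_diff hessian_lip x d.
  have -> : gradient f (x + d) = (gradient f (x + d) - gradient f x
      - d *m hessian f x) + (w - (s / 3 * h) *: d).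
    rewrite /w dB (addrAC _ _ (gradient f x)) addrK -[_ - _ - _]addrA -opprD.
    by rewrite [d *m _ + _]addrC subrK.
  apply: le_trans (ler_enormD _ _) _.
  have := ler_enormD w (- ((s / 3 * h) *: d)).
  have c0 : 0 <= s / 3 * h by rewrite mulr_ge0 ?divr_ge0// ltW.
  rewrite enormN enormZ (ger0_norm c0).
  have sq : 9 * (M * enorm d ^+ 2) <= g.
    rewrite ME gE (_ : 9 * _ = (3 * s * enorm d) ^+ 2); last by ring.
    by rewrite ler_pXn2r// nnegrE ?mulr_ge0// ltW.
  have lin : 3 * (s * h * enorm d) <= g.
    rewrite gE (_ : 3 * _ = h * (3 * s * enorm d)); last by ring.
    by rewrite expr2 ler_pM2l.
  move: G; lra.
have dd0 : 0 <= 5 / 18 * (s * h) * enorm d ^+ 2.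
  by rewrite mulr_ge0 ?sqr_ge0// mulr_ge0// mulr_ge0// ltW.
split; first by apply: le_trans descent _; rewrite gerBl.
have [w_eq0|w_neq0] := eqVneq (enorm w) 0.
  by left; apply: le_trans grad_le _; rewrite w_eq0 addr0.
right; split; first lra.
(* equality in Cauchy-Schwarz forces d to the boundary of the region *)
have d_eq : enorm d = rho.
  apply/eqP; rewrite eq_le d_rho /=.
  have wgt0 : 0 < enorm w by rewrite lt_def w_neq0.
  rewrite -(ler_pM2r wgt0); apply: le_trans opt _.
  by rewrite -dotNr mulrC; apply: le_trans (dot_le_enorm _ _) _; rewrite enormN.
apply: le_trans descent _; rewrite d_eq gE /rho.
by rewrite le_eqVlt; apply/orP; left; apply/eqP; field; rewrite gt_eqF.
Qed.

End Step.

(** * Counting the iterations *)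

Section Counting.
Context {R : realType}.

Lemma ln_le_subr1 (x : R) : 0 < x -> ln x <= x - 1.
Proof.
move=> x0; have := expR_ge1Dx (ln x); rewrite lnK ?posrE//; lra.
Qed.

(** Discrete form of (1 / sqrt delta)' = - delta' / (2 delta^(3/2)): the
    inequality (1 - t) (1 + t/2)^2 <= 1 at t = kappa sqrt a. *)
Lemma inv_sqrt_gain (kappa a b : R) : 0 < kappa -> 0 < a -> 0 < b ->
  b <= a - kappa * (a * Num.sqrt a) ->
  (Num.sqrt a)^-1 + kappa / 2 <= (Num.sqrt b)^-1.
Proof.
move=> k0 a0 b0.
set p := Num.sqrt a; set q := Num.sqrt b.
have p0 : 0 < p by rewrite sqrtr_gt0.
have q0 : 0 < q by rewrite sqrtr_gt0.
have -> : a = p ^+ 2 by rewrite sqr_sqrtr// ltW.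
have -> : b = q ^+ 2 by rewrite sqr_sqrtr// ltW.
move=> H.
have t0 : 0 < kappa * p by rewrite mulr_gt0.
have u0 : 0 < 1 + kappa * p / 2 by rewrite addr_gt0// divr_gt0.
have : q * (1 + kappa * p / 2) <= p.
  rewrite -(@ler_pXn2r _ 2)// ?nnegrE ?(ltW p0) ?(ltW (mulr_gt0 q0 u0))// exprMn.
  apply: le_trans (ler_wpM2r (sqr_ge0 _) H) _.
  rewrite -subr_ge0.
  rewrite (_ : _ - _ = p ^+ 2 * ((kappa * p) ^+ 2 * (3 / 4 + kappa * p / 4)));
    last by field.
  by rewrite mulr_ge0 ?sqr_ge0// mulr_ge0 ?sqr_ge0// addr_ge0// divr_ge0// ltW.
move=> qp; rewrite -(ler_pM2l (mulr_gt0 q0 p0)).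
apply: le_trans (_ : q * (1 + kappa * p / 2) <= _).
  by rewrite le_eqVlt; apply/orP; left; apply/eqP; field; rewrite gt_eqF.
by rewrite (_ : q * p / q = p)//; field; rewrite gt_eqF.
Qed.

(** The potential 2 ln g - (3 / kappa) / sqrt delta drops by at least 1 at each
    step: a step of the first kind divides g by 6, and a step of the second
    kind raises ln g by at most 1/6 but 1 / sqrt delta by kappa / 2. *)
Lemma step_count (kappa : R) (g delta : nat -> R) (N : nat) : 0 < kappa ->
  (forall k, (k <= N)%N -> 0 < g k) ->
  (forall k, (k <= N)%N -> 0 < delta k) ->
  (forall k, (k < N)%N -> delta k.+1 <= delta k /\
     (g k.+1 <= g k / 6 \/ g k.+1 <= 7 / 6 * g k /\
      delta k.+1 <= delta k - kappa * (delta k * Num.sqrt (delta k)))) ->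
  N%:R <= 2 * (ln (g 0%N) - ln (g N)) + 3 / kappa / Num.sqrt (delta N).
Proof.
move=> k0 g0 d0 step.
suff : N%:R <= 2 * (ln (g 0%N) - ln (g N)) +
    3 / kappa * ((Num.sqrt (delta N))^-1 - (Num.sqrt (delta 0%N))^-1).
  move=> /le_trans; apply; rewrite lerD2l ler_wpM2l ?divr_ge0 ?(ltW k0)//.
  by rewrite gerBl invr_ge0 sqrtr_ge0.
elim: N g0 d0 step => [|N IH] g0 d0 step; first by rewrite !subrr !mulr0 addr0.
have {}IH := IH (fun k kN => g0 k (leqW kN)) (fun k kN => d0 k (leqW kN))
  (fun k kN => step k (leqW kN)).
have gN := g0 N (leqnSn N); have gS := g0 N.+1 (leqnn _).
have dN := d0 N (leqnSn N); have dS := d0 N.+1 (leqnn _).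
have [d_le alt] := step N (leqnn _).
have lnE : ln (g N.+1) - ln (g N) <= g N.+1 / g N - 1.
  by rewrite -ln_div ?posrE// ln_le_subr1// divr_gt0.
have gE : g N.+1 / g N * g N = g N.+1 by rewrite divfK// gt_eqF.
rewrite -natr1.
have [g_le|[g_le dec]] := alt.
  have : (Num.sqrt (delta N))^-1 <= (Num.sqrt (delta N.+1))^-1.
    by rewrite lef_pV2 ?posrE ?sqrtr_gt0// ler_wsqrtr.
  have c0 : 0 <= 3 / kappa by rewrite divr_ge0// ltW.
  move=> /(ler_wpM2l c0).
  have : g N.+1 / g N <= 6^-1 by rewrite ler_pdivrMr// mulrC.
  lra.
have c0 : 0 <= 3 / kappa by rewrite divr_ge0// ltW.
have := ler_wpM2l c0 (inv_sqrt_gain k0 dN dS dec).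
have -> : 3 / kappa * ((Num.sqrt (delta N))^-1 + kappa / 2) =
   3 / kappa * (Num.sqrt (delta N))^-1 + 3 / 2.
  by rewrite mulrDr; congr (_ + _); field; rewrite gt_eqF.
have : g N.+1 / g N <= 7 / 6 by rewrite ler_pdivrMr.
lra.
Qed.

End Counting.

Section Iteration.
Context {R : realType} {n : nat} (f : 'rV[R]_n -> R) (M D : R).
Context (x0 xstar : 'rV[R]_n) (x : nat -> 'rV[R]_n).
Hypothesis M_gt0 : 0 < M.
Hypothesis D_gt0 : 0 < D.
Hypothesis f_convex : convex_function (setT : set (convex_lmodType 'rV[R]_n)) f.
Hypothesis f_diff : twice_differentiable f.
Hypothesis hessian_lip :
  forall y z, opnorm (hessian f y - hessian f z) <= M * enorm (y - z).
Hypothesis sublevel_bounded : forall y, f y <= f x0 -> enorm (y - xstar) <= D.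

(** The tangent inequality at y towards the minimiser, with Cauchy-Schwarz. *)
Lemma gap_le_gradient y : f y <= f x0 ->
  f y - f xstar <= enorm (gradient f y) * D.
Proof.
move=> y_le.
have C := convex_tangent (ltW M_gt0) f_diff hessian_lip f_convex y xstar.
have H : - dot (gradient f y) (xstar - y) <= enorm (gradient f y) * D.
  rewrite -dotNr opprB; apply: le_trans (dot_le_enorm _ _) _.
  by rewrite ler_wpM2l ?enorm_ge0// sublevel_bounded.
by move: C H; lra.
Qed.

(** A gap above (1 + D) eps at y forces both the gap and the gradient norm above
    eps: the gap is at most D times the gradient norm. The constant 100 bounds
    3 * 162 / 5, from 3 / kappa. *)
Lemma iteration_bound (eps : R) (N : nat) : 0 < eps ->
  utr_simple f M x0 x ->
  (forall k, (k <= N)%N -> (1 + D) * eps < f (x k) - f xstar) ->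
  N%:R <= 2 * ln (enorm (gradient f x0) / eps) +
    100 * (Num.sqrt M * (D * Num.sqrt D) / Num.sqrt eps).
Proof.
move=> eps0 [xinit xstep] gap_gt.
pose g k := enorm (gradient f (x k)).
pose delta k := f (x k) - f xstar.
have s0 : 0 < Num.sqrt M by rewrite sqrtr_gt0.
have sD0 : 0 < Num.sqrt D by rewrite sqrtr_gt0.
have gap_eps k : (k <= N)%N -> eps < delta k.
  by move=> kN; apply: le_lt_trans (gap_gt k kN); rewrite ler_peMl ?ltW// ltrDl.
have gap0 k : (k <= N)%N -> 0 < delta k.
  by move=> kN; apply: lt_trans (gap_eps k kN).
have grad_gt y : f y <= f x0 -> (1 + D) * eps < f y - f xstar ->
    eps < enorm (gradient f y).
  move=> y_le y_gap; rewrite -(ltr_pM2r D_gt0).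
  apply: lt_le_trans (gap_le_gradient y_le); apply: le_lt_trans y_gap.
  by rewrite mulrC ler_pM2r// lerDr.
have progress k : f (x k) <= f x0 -> (k <= N)%N ->
   f (x k.+1) <= f (x k) /\ (g k.+1 <= g k / 6 \/ g k.+1 <= 7 / 6 * g k /\
     f (x k.+1) <= f (x k) - 5 / 162 * (g k * Num.sqrt (g k)) / Num.sqrt M).
  move=> k_le kN; have gk := lt_trans eps0 (grad_gt _ k_le (gap_gt k kN)).
  have [d d_sol xE] := xstep k; rewrite /g xE.
  exact: (step_progress M_gt0 f_diff hessian_lip f_convex d_sol gk).
have mono k : (k <= N)%N -> f (x k) <= f x0.
  elim: k => [|k IH] kN; first by rewrite xinit.
  have k_le := IH (ltnW kN).
  exact: le_trans (progress k k_le (ltnW kN)).1 k_le.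
pose kappa := 5 / 162 / (Num.sqrt M * (D * Num.sqrt D)).
have kappa0 : 0 < kappa by rewrite !divr_gt0// ?mulr_gt0.
have g_eps k : (k <= N)%N -> eps < g k.
  by move=> kN; exact: grad_gt (mono k kN) (gap_gt k kN).
have := @step_count R kappa g delta N kappa0
  (fun k kN => lt_trans eps0 (g_eps k kN)) gap0.
have step k : (k < N)%N -> delta k.+1 <= delta k /\
     (g k.+1 <= g k / 6 \/ g k.+1 <= 7 / 6 * g k /\
      delta k.+1 <= delta k - kappa * (delta k * Num.sqrt (delta k))).
  move=> kN; have [f_le alt] := progress k (mono k (ltnW kN)) (ltnW kN).
  split; first by rewrite lerD2r.
  have [|[g_le dec]] := alt; [by left|right; split => //].
  rewrite /delta; apply: le_trans (lerB dec (lexx _)) _; rewrite -/(delta k).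
  suff : kappa * (delta k * Num.sqrt (delta k)) <=
      5 / 162 * (g k * Num.sqrt (g k)) / Num.sqrt M by rewrite /delta; lra.
  have dg : delta k <= g k * D := gap_le_gradient (mono k (ltnW kN)).
  have gk0 : 0 <= g k := enorm_ge0 _.
  have : delta k * Num.sqrt (delta k) <=
      g k * Num.sqrt (g k) * (D * Num.sqrt D).
    rewrite mulrACA -sqrtrM//; apply: ler_pM; rewrite ?sqrtr_ge0//.
      exact: ltW (gap0 k (ltnW kN)).
    exact: ler_wsqrtr.
  move=> /(ler_wpM2l (ltW kappa0)) /le_trans; apply.
  by rewrite /kappa le_eqVlt; apply/orP; left; apply/eqP; field;
    rewrite !gt_eqF.
move=> /(_ step) /le_trans; apply.
have g00 : 0 < g 0%N by apply: lt_trans (g_eps 0%N (leq0n _)).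
apply: lerD.
  have -> : enorm (gradient f x0) = g 0%N by rewrite /g xinit.
  rewrite ln_div ?posrE// ler_pM2l// lerB// ler_ln ?posrE//.
    exact: ltW (g_eps N (leqnn N)).
  exact: lt_trans (g_eps N (leqnn N)).
have -> : 3 / kappa = 486 / 5 * (Num.sqrt M * (D * Num.sqrt D)).
  by rewrite /kappa; field; rewrite !gt_eqF.
set Q := Num.sqrt M * _; have Q0 : 0 <= Q by rewrite !mulr_ge0// ltW.
rewrite [leRHS]mulrA; apply: ler_pM.
- by rewrite mulr_ge0.
- by rewrite invr_ge0 sqrtr_ge0.
- by rewrite ler_wpM2r//; lra.
have dN := gap_eps N (leqnn N).
by rewrite lef_pV2 ?posrE ?sqrtr_gt0 ?(lt_trans eps0 dN)// ler_wsqrtr// ltW.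
Qed.

End Iteration.

(* C is absolute; K depends on D only; the threshold below which eps has to
   lie depends on M, D and G = ||gradient f x0|| only, so the bound is uniform
   over the dimension, the function, the starting point and the iterates. *)
Theorem theorem3p2 (R : realType) :
  exists2 C : R, 0 < C &
  forall D : R, 0 < D ->
  exists2 K : R, 0 < K &
  forall M G : R, 0 < M ->
  \forall eps \near 0^'+,
  forall (n : nat) (f : 'rV[R]_n -> R) (x0 xstar : 'rV[R]_n)
         (x : nat -> 'rV[R]_n),
  convex_function (setT : set (convex_lmodType 'rV[R]_n)) f ->
  twice_differentiable f ->
  has_lbound (range f) ->
  (forall y z, opnorm (hessian f y - hessian f z) <= M * enorm (y - z)) ->
  (forall y, f xstar <= f y) ->
  (forall y, f y <= f x0 -> enorm (y - xstar) <= D) ->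
  enorm (gradient f x0) = G ->
  utr_simple f M x0 x ->
  exists2 k : nat,
    k%:R <= C * (Num.sqrt M * D `^ (3 / 2) * eps `^ (- (1 / 2)) +
                 ln (enorm (gradient f x0) / eps)) &
    f (x k) - inf (range f) <= K * eps.
Proof.
exists 200 => // D D0; exists (1 + D); first by rewrite addr_gt0.
move=> M G M0.
(* below this threshold ln (G / eps) >= ln 3 >= 1/2 whenever G > 0 *)
pose thr : R := if 0 < G then G / 3 else 1.
have thr0 : 0 < thr by rewrite /thr; case: ifP => // G0; rewrite divr_gt0.
near=> eps.
have eps0 : 0 < eps by near: eps; exact: nbhs_right_gt.
have eps_thr : eps < thr by near: eps; exact: nbhs_right_lt.
move=> n f x0 xstar x f_convex f_diff f_lb hess_lip f_min sublevel gradG utr.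
have inf_f : inf (range f) = f xstar.
  apply/eqP; rewrite eq_le; apply/andP; split.
    by apply: ge_inf => //; exists xstar.
  by apply: lb_le_inf; [exists (f xstar); exists xstar|move=> _ [y _ <-]].
rewrite inf_f.
have D32 : D `^ (3 / 2) = D * Num.sqrt D.
  have -> : 3 / 2 = 1 + 2^-1 :> R by lra.
  by rewrite powRD ?gt_eqF ?implybT// powRr1 ?powR12_sqrt// ltW.
have eps12 : eps `^ (- (1 / 2)) = (Num.sqrt eps)^-1.
  by rewrite powRN div1r powR12_sqrt// ltW.
rewrite D32 eps12 gradG.
set P := Num.sqrt M * _ / _.
have P0 : 0 <= P by rewrite !mulr_ge0 ?invr_ge0 ?sqrtr_ge0// ltW.
have [G0|G0] := leP G 0.
  exists 0%N.
    rewrite mulr_ge0// addr_ge0// ln0// pmulr_lle0 ?invr_gt0//.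
  have [-> _] := utr.
  apply: (@le_trans _ _ 0); last by rewrite mulr_ge0 ?addr_ge0 ?ltW.
  apply: le_trans (gap_le_gradient M0 f_convex f_diff hess_lip sublevel (lexx _)) _.
  by rewrite gradG pmulr_lle0.
have L1 : 1 / 2 <= ln (G / eps).
  have r3 : 3 <= G / eps.
    by rewrite ler_pdivlMr//; move: eps_thr; rewrite /thr G0; lra.
  have rgt0 : 0 < G / eps by rewrite divr_gt0.
  have := @ln_le_subr1 R (G / eps)^-1.
  rewrite invr_gt0 lnV ?posrE// => /(_ rgt0).
  have : (G / eps)^-1 <= 3^-1 by rewrite lef_pV2 ?posrE.
  lra.
set T := 200 * _.
have T0 : 0 <= T by rewrite /T; lra.
apply: contrapT => none.
have := truncn_itv T0 => /andP[N_le N_gt].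
set N := Num.truncn T in N_le N_gt.
have gap k : (k <= N)%N -> (1 + D) * eps < f (x k) - f xstar.
  move=> kN; rewrite ltNge; apply/negP => small; apply: none.
  by exists k => //; apply: le_trans N_le; rewrite ler_nat.
have := iteration_bound M0 D0 f_convex f_diff hess_lip sublevel eps0 utr gap.
rewrite gradG -/P; move: N_gt; rewrite -natr1 /T; lra.
Unshelve. all: by end_near.
Qed.
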